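(* Let $\Phi\in\{\Gamma_k,\mathcal{K}\}$, $\Psi\in\{\Gamma,\Omega\}$ and $\star\in\{1,fin\}$. Then for a $k$-perfect space $X$ the following statements are equivalent: (1) $X$ satisfies $S_\star(\Phi,\Psi)$; (2) $(2^X,\mathbf{F}^+,\mathbf{Z}^+)$ satisfies $S_\star(\mathcal{D}^{\mathbf{F}^+}_\Phi,\mathcal{D}^{\mathbf{Z}^+}_\Psi)$; (3) for each $E\in 2^X$, $(2^X,\mathbf{F}^+,\mathbf{Z}^+)$ satisfies $S_\star(\Phi^{\mathbf{F}^+}_E,\Psi^{\mathbf{Z}^+}_E)$.
   Context: Standing assumption: all spaces are Hausdorff and non-compact unless otherwise stated. A subset $A$ of a space $X$ is a $k$-$F_\sigma$-set if $A=\bigcup_{i=1}^\infty F_i$ with each $F_i$ closed in $X$ and such that for any compact $B\subseteq A$ there is $i'\in\mathbb{N}$ with $B\subseteq F_{i'}$. A space $X$ is $k$-perfect if every open subset is a $k$-$F_\sigma$-subset of $X$. For a space $X$, $2^X$ is the family of all closed subsets of $X$ (including $\emptyset$). For $A\subseteq X$ put $A^c=X\setminus A$ and $A^+=\{F\in 2^X: F\subseteq A\}$. The upper Fell topology $\mathbf{F}^+$ on $2^X$ has base $\{(D^c)^+: D\subseteq X \text{ non-empty compact}\}\cup\{2^X\}$; the $\mathbf{Z}^+$-topology has base $\{(D^c)^+: D\subseteq X \text{ non-empty finite}\}\cup\{2^X\}$. Covers are non-trivial: $\mathcal{U}$ is a cover of $X$ if $X=\bigcup\mathcal{U}$ and $X\notin\mathcal{U}$.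 An open cover $\mathcal{U}$ of $X$ is an $\omega$-cover (a $k$-cover) if each finite (compact) subset of $X$ is contained in an element of $\mathcal{U}$; it is a $\gamma$-cover (a $\gamma_k$-cover) if it is infinite and for each finite (compact) $C\subseteq X$ the set $\{U\in\mathcal{U}: C\not\subseteq U\}$ is finite. $\Omega,\mathcal{K},\Gamma,\Gamma_k$ are the families of all open $\omega$-covers, $k$-covers, $\gamma$-covers, $\gamma_k$-covers of $X$, respectively. Selection principles: $S_1(\mathcal{A},\mathcal{B})$ says that for each sequence $(A_n)_{n\in\mathbb{N}}$ of elements of $\mathcal{A}$ there are $b_n\in A_n$ ($n\in\mathbb{N}$) such that $\{b_n:n\in\mathbb{N}\}\in\mathcal{B}$. $S_{fin}(\mathcal{A},\mathcal{B})$ says that for each sequence $(A_n)_{n\in\mathbb{N}}$ of elements of $\mathcal{A}$ there are finite sets $B_n\subseteq A_n$ such that $\bigcup_{n\in\mathbb{N}}B_n\in\mathcal{B}$. For $\tau\in\{\mathbf{F}^+,\mathbf{Z}^+\}$: $\mathcal{D}^\tau_\Omega$ is the family of all dense subsets $\mathcal{A}$ of $(2^X,\tau)$ with $\emptyset\notin\mathcal{A}$; $\mathcal{D}^\tau_\Gamma$ is the family of all infinite $\mathcal{A}\subseteq 2^X$ with $\emptyset\notin\mathcal{A}$ that converge to $\{\emptyset\}$, meaning that for every $F\in 2^X$ and every $\tau$-neighborhood $W$ of $F$ the set $\{A\in\mathcal{A}: A\notin W\}$ is finite. Moreover $\mathcal{D}^{\mathbf{F}^+}_{\mathcal{K}}:=\mathcal{D}^{\mathbf{F}^+}_\Omega$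 and $\mathcal{D}^{\mathbf{F}^+}_{\Gamma_k}:=\mathcal{D}^{\mathbf{F}^+}_\Gamma$. For $E\in 2^X$: $\Omega^\tau_E=\{\mathcal{A}\subseteq 2^X: E\in\overline{\mathcal{A}}\setminus\mathcal{A}\}$ with closure in $(2^X,\tau)$, and $\Gamma^\tau_E$ is the set of non-trivial sequences converging to $E$ in $(2^X,\tau)$, i.e. of all sets $\mathcal{A}=\{A_n:n\in\mathbb{N}\}\subseteq 2^X$ with $E\notin\mathcal{A}$ for which the sequence $(A_n)$ (repetitions allowed) $\tau$-converges to $E$. $\Phi^{\mathbf{F}^+}_E$ denotes $\Omega^{\mathbf{F}^+}_E$ if $\Phi=\mathcal{K}$ and $\Gamma^{\mathbf{F}^+}_E$ if $\Phi=\Gamma_k$; $\Psi^{\mathbf{Z}^+}_E$ denotes $\Omega^{\mathbf{Z}^+}_E$ if $\Psi=\Omega$ and $\Gamma^{\mathbf{Z}^+}_E$ if $\Psi=\Gamma$. *)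

(* Defs.v *)
From HB Require Import structures.
From mathcomp Require Import all_boot.
From mathcomp Require Import all_classical topology.

Set Implicit Arguments.
Unset Strict Implicit.
Unset Printing Implicit Defensive.

Local Open Scope classical_set_scope.

Definition kFsigma (X : topologicalType) (A : set X) : Prop :=
  exists F : nat -> set X,
    [/\ A = \bigcup_i F i,
        forall i, closed (F i) &
        forall B, compact B -> B `<=` A -> exists i, B `<=` F i].

Definition kperfect (X : topologicalType) : Prop :=
  forall A : set X, open A -> kFsigma A.

Section Covers.
Variable X : topologicalType.
Implicit Types (U : set (set X)) (V C : set X).

Definition open_cover U : Prop :=
  [/\ forall V, U V -> open V, \bigcup_(V in U) V = [set: X] & ~ U [set: X]].

(* [tests] is [finite_set] (omega- and gamma-covers) or [compact]
   (k- and gamma_k-covers). *)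
Definition omega_covers (tests : set (set X)) : set (set (set X)) :=
  [set U | open_cover U /\
           forall C, tests C -> exists2 V, U V & C `<=` V].

Definition gamma_covers (tests : set (set X)) : set (set (set X)) :=
  [set U | [/\ open_cover U, infinite_set U &
           forall C, tests C -> finite_set [set V | U V /\ ~ C `<=` V]]].

End Covers.

Inductive selection_kind := SelOne | SelFin.

Section Selection.
Variable T : Type.
Implicit Types A B : set (set T).

Definition S1 A B : Prop :=
  forall a : nat -> set T, (forall n, A (a n)) ->
    exists b : nat -> T, (forall n, a n (b n)) /\ B (range b).

Definition Sfin A B : Prop :=
  forall a : nat -> set T, (forall n, A (a n)) ->
    exists b : nat -> set T,
      (forall n, finite_set (b n) /\ b n `<=` a n) /\ B (\bigcup_n b n).

Definition selects (s : selection_kind) A B : Prop :=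
  match s with SelOne => S1 A B | SelFin => Sfin A B end.

End Selection.

Record closed_subset (X : topologicalType) := ClosedSubset {
  closed_subset_set :> set X;
  closed_subsetP : closed closed_subset_set }.

Definition empty_closed (X : topologicalType) : closed_subset X :=
  ClosedSubset (@closed0 X).

Definition upper_set (X : topologicalType) (A : set X) :
    set (closed_subset X) :=
  [set F : closed_subset X | F `<=` A].

Inductive upper_topology := UpperFell | UpperZ.

Definition upper_tests (t : upper_topology) (X : topologicalType) :
    set (set X) :=
  match t with UpperFell => @compact X | UpperZ => @finite_set X end.

Definition upper_base (t : upper_topology) (X : topologicalType) :
    set (set (closed_subset X)) :=
  [set upper_set (~` D) | D in [set D | upper_tests t D /\ D !=set0]]
    `|` [set setT].

(* The same carrier for both [t], which only selects the topology. *)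
Definition hyperspace (t : upper_topology) (X : topologicalType) : Type :=
  closed_subset X.

Section HyperspaceTopology.
Variables (t : upper_topology) (X : topologicalType).

Let base_cover : \bigcup_(W in @upper_base t X) W = setT.
Proof. by rewrite -subTset => F _; exists setT => //; right. Qed.

Let upper_testsU (D E : set X) :
  upper_tests t D -> upper_tests t E -> upper_tests t (D `|` E).
Proof.
by case: t => /=; [exact: compactU | move=> ? ?; rewrite finite_setU].
Qed.

Let base_join (V W : set (closed_subset X)) (F : closed_subset X) :
  upper_base t V -> upper_base t W -> V F -> W F ->
  exists O, [/\ upper_base t O, O F & O `<=` V `&` W].
Proof.
move=> [[D [tD D0] <-]|->]; last by move=> bW _ WF; exists W; split.
move=> [[E [tE E0] <-]|->] FD FE; last first.
  by exists (upper_set (~` D)); split => //; left; exists D.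
exists (upper_set (~` (D `|` E))); split.
- left; exists (D `|` E) => //; split; first exact: upper_testsU.
  by case: D0 => x Dx; exists x; left.
- by move=> x Fx; rewrite setCU; split; [exact: FD | exact: FE].
- by move=> G GDE; split=> x /GDE; rewrite setCU => -[].
Qed.

HB.instance Definition _ := gen_eqMixin (hyperspace t X).
HB.instance Definition _ := gen_choiceMixin (hyperspace t X).
HB.instance Definition _ :=
  @isBaseTopological.Build (hyperspace t X) (set (closed_subset X))
    (@upper_base t X) id base_cover base_join.

Lemma open_hyperspaceE (W : set (hyperspace t X)) :
  open W <-> exists2 B, B `<=` @upper_base t X & \bigcup_(O in B) O = W.
Proof. by []. Qed.

End HyperspaceTopology.

Section Families.
Variables (t : upper_topology) (X : topologicalType).
Implicit Type A : set (closed_subset X).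

Definition D_Omega : set (set (closed_subset X)) :=
  [set A | dense (A : set (hyperspace t X)) /\ ~ A (empty_closed X)].

Definition D_Gamma : set (set (closed_subset X)) :=
  [set A | [/\ infinite_set A, ~ A (empty_closed X) &
     forall (F : hyperspace t X) (W : set (hyperspace t X)), nbhs F W ->
       finite_set [set G | A G /\ ~ W G]]].

Definition Omega_at (E : closed_subset X) : set (set (closed_subset X)) :=
  [set A | (closure (A : set (hyperspace t X)) `\` A) E].

Definition Gamma_at (E : closed_subset X) : set (set (closed_subset X)) :=
  [set A | ~ A E /\
     exists2 a : nat -> hyperspace t X,
       A = range a & a n @[n --> \oo] --> (E : hyperspace t X)].

End Families.

Inductive phi_class := Phi_Gamma_k | Phi_K.
Inductive psi_class := Psi_Gamma | Psi_Omega.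

Section Classes.
Variable X : topologicalType.

Definition covers_phi (c : phi_class) : set (set (set X)) :=
  match c with
  | Phi_Gamma_k => gamma_covers (@compact X)
  | Phi_K => omega_covers (@compact X)
  end.

Definition covers_psi (c : psi_class) : set (set (set X)) :=
  match c with
  | Psi_Gamma => gamma_covers (@finite_set X)
  | Psi_Omega => omega_covers (@finite_set X)
  end.

Definition D_phi (c : phi_class) : set (set (closed_subset X)) :=
  match c with
  | Phi_Gamma_k => @D_Gamma UpperFell X
  | Phi_K => @D_Omega UpperFell X
  end.

Definition D_psi (c : psi_class) : set (set (closed_subset X)) :=
  match c with
  | Psi_Gamma => @D_Gamma UpperZ X
  | Psi_Omega => @D_Omega UpperZ X
  end.

Definition phi_at (c : phi_class) (E : closed_subset X) :
    set (set (closed_subset X)) :=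
  match c with
  | Phi_Gamma_k => Gamma_at UpperFell E
  | Phi_K => Omega_at UpperFell E
  end.

Definition psi_at (c : psi_class) (E : closed_subset X) :
    set (set (closed_subset X)) :=
  match c with
  | Psi_Gamma => Gamma_at UpperZ E
  | Psi_Omega => Omega_at UpperZ E
  end.

End Classes.

(* Main.v *)
(** Complementation turns covers of [X] into dense or convergent families of
    closed sets, which gives (1) <-> (2), and (3) at [E = set0] gives (2).
    For (1) -> (3), let [G n] be increasing closed sets exhausting [~` E], in the
    sense that every compact subset of [~` E] is eventually contained in [G n].
    If some member of the [n]-th family misses [G n], select it.  Otherwise the
    sets [~` F `|` ~` G n], for [F] in the [n]-th family, are proper and form a
    cover of [X] of the required class, to which (1) applies.  A compact
    [C `<=` G n] lies in [~` F `|` ~` G n] exactly when it misses [F], so both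
    kinds of choices together approach [E]. *)
Require Import Defs.
From mathcomp Require Import all_boot finmap.
From mathcomp Require Import all_classical topology.

Local Open Scope classical_set_scope.

(** * Infinite sets and sequences that eventually avoid finite subsets *)

Lemma near_finite_set (P : set nat) :
  (\forall n \near \oo, ~ P n) <-> finite_set P.
Proof.
split=> [[N _ NP]|/finite_fsetP[D ->]].
  apply: sub_finite_set (finite_II N) => n Pn /=.
  by rewrite ltnNge; apply/negP => /NP /(_ Pn).
exists (\max_(i <- D) i).+1 => // n /= Dn nD.
by have /(leq_ltn_trans (leq_bigmax_seq (F := id) _ nD isT)) := Dn; rewrite ltnn.
Qed.

(** An injection of [nat] into [A] works, since it takes values in a finite subset of [A] only
    finitely often. *)
Lemma infinite_set_sequence (T : Type) (A : set T) : infinite_set A ->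
  exists u : nat -> T, (forall n, A (u n)) /\
    forall P : set T, finite_set (A `&` P) -> \forall n \near \oo, ~ P (u n).
Proof.
move=> /infiniteP /card_leP[f].
pose j (n : nat) : [set: nat] := exist _ n (mem_set I).
have uA n : A (\val (f (j n))) by exact: set_valP.
exists (fun n => \val (f (j n))); split => // P finP.
apply/near_finite_set.
rewrite (_ : (fun _ => _) = (fun n => \val (f (j n))) @^-1` (A `&` P)).
  apply: finite_preimage => // m n _ _ /val_inj.
  by move=> /'inj_f; rewrite !in_setT => /(_ isT isT) [].
by apply/seteqP; split=> n /= => [Pn|[]//]; split => //; exact: uA.
Qed.

Lemma finite_range_near (T : Type) (u : nat -> T) (P : set T) :
  (\forall n \near \oo, ~ P (u n)) -> finite_set (range u `&` P).
Proof.
move=> /near_finite_set /(finite_image u); apply: sub_finite_set.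
by move=> _ [[n _ <-] Pn]; exists n.
Qed.

(** If the range were finite, its finitely many fibres, each finite by hypothesis, would cover
    [nat]. *)
Lemma infinite_range_near (T : Type) (u : nat -> T) :
  (forall k, \forall n \near \oo, u n <> u k) -> infinite_set (range u).
Proof.
move=> uk fin_u; apply: infinite_nat.
have : finite_set (\bigcup_(y in range u) u @^-1` [set y]).
  by apply: bigcup_finite => // _ [k _ <-]; apply/near_finite_set; exact: uk.
by apply: sub_finite_set => n _; exists (u n) => //; exists n.
Qed.

(** * Neighborhoods, closure and convergence in the upper topologies *)

Section Hyperspace.
Variables (t : upper_topology) (X : topologicalType).
Implicit Types (E F : closed_subset X) (A : set (closed_subset X)) (C : set X).

Lemma upper_tests1 (x : X) : upper_tests t [set x].
Proof. by case: t; [exact: compact_set1 | exact: finite_set1]. Qed.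

Lemma upper_tests0 : upper_tests t (@set0 X).
Proof. by case: t; [exact: compact0 | exact: finite_set0]. Qed.

Lemma open_upper_set C : upper_tests t C ->
  open (upper_set (~` C) : set (hyperspace t X)).
Proof.
move=> tC; have [->|C0] := eqVneq C set0.
  rewrite (_ : upper_set _ = setT); first exact: openT.
  by apply/seteqP; split=> // F _ x _ [].
apply/open_hyperspaceE; exists [set upper_set (~` C)]; last exact: bigcup_set1.
by move=> _ ->; left; exists C => //; split => //; exact/set0P.
Qed.

(** Here [C] may be empty: this value accounts for the base element [setT], so that later arguments
    treat all basic neighborhoods alike. *)
Lemma nbhs_hyperspaceP E (W : set (hyperspace t X)) :
  nbhs (E : hyperspace t X) W <->
  exists C, [/\ upper_tests t C, C `<=` ~` E & upper_set (~` C) `<=` W].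
Proof.
rewrite nbhsE; split => [[V [/open_hyperspaceE[B Bbase <-] [O BO OE]] VW]|].
  have OW : O `<=` W by move=> F OF; apply: VW; exists O.
  case: (Bbase _ BO) OE OW => [[D [tD _] <-] ED DW|-> _ TW].
    by exists D; split => // x Dx Ex; exact: ED Ex Dx.
  by exists set0; split => //; [exact: upper_tests0 | move=> F _; exact: TW].
move=> [C [tC CE CW]]; exists (upper_set (~` C)) => //; split.
  exact: open_upper_set.
by move=> x Ex Cx; exact: CE Cx Ex.
Qed.

Lemma nbhs_upper_set E C : upper_tests t C -> C `<=` ~` E ->
  nbhs (E : hyperspace t X) (upper_set (~` C)).
Proof.
move=> tC CE; apply: open_nbhs_nbhs; split; first exact: open_upper_set.
by move=> x Ex Cx; exact: CE Cx Ex.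
Qed.

Lemma Omega_atP E A : Omega_at t E A <->
  ~ A E /\ forall C, upper_tests t C -> C `<=` ~` E ->
    exists2 F, A F & C `<=` ~` F.
Proof.
split=> [[clE AE]|[AE tE]]; split=> //.
  move=> C tC CE; have /clE[F [AF FC]] := nbhs_upper_set _ _ tC CE.
  by exists F => // x Cx Fx; exact: FC Fx Cx.
move=> W /nbhs_hyperspaceP[C [tC CE CW]].
have [F AF CF] := tE _ tC CE; exists F; split => //.
by apply: CW => x Fx Cx; exact: CF Cx Fx.
Qed.

Lemma hyperspace_cvgP E (u : nat -> hyperspace t X) :
  u n @[n --> \oo] --> (E : hyperspace t X) <->
  forall C, upper_tests t C -> C `<=` ~` E ->
    \forall n \near \oo, C `<=` ~` (u n : closed_subset X).
Proof.
split=> [uE C tC CE|uE W /nbhs_hyperspaceP[C [tC CE CW]]].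
  have uC : \forall n \near \oo, upper_set (~` C) (u n).
    by have /uE := nbhs_upper_set _ _ tC CE.
  by apply: filterS uC => n FC x Cx Fx; exact: FC Fx Cx.
by apply: filterS (uE C tC CE) => n Cu; apply: CW => x ux Cx; exact: Cu Cx ux.
Qed.

Lemma D_OmegaE : @D_Omega t X = Omega_at t (empty_closed X).
Proof.
apply/seteqP; split=> A [dA A0]; split=> //.
  move=> W; rewrite nbhsE => -[V [oV V0] VW].
  have [|F [VF AF]] := dA V _ oV; first by exists (empty_closed X).
  by exists F; split => //; exact: VW.
move=> V [F VF] oV.
have /nbhs_hyperspaceP[C [tC CF CV]] : nbhs (F : hyperspace t X) V.
  exact: open_nbhs_nbhs.
have /dA[G [AG VG]] : nbhs (empty_closed X : hyperspace t X) V.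
  by apply/nbhs_hyperspaceP; exists C; split => // x _ [].
by exists G.
Qed.

(** As for density, neighborhoods of an arbitrary [F] contain neighborhoods of the empty set, so
    convergence has to be tested only there. *)
Lemma D_GammaP A : D_Gamma t A <->
  [/\ infinite_set A, ~ A (empty_closed X) &
    forall C, upper_tests t C -> finite_set [set F | A F /\ ~ C `<=` ~` F]].
Proof.
split=> -[Ainf A0 fin]; split=> //.
  move=> C tC; have /fin : nbhs (empty_closed X : hyperspace t X) (upper_set (~` C)).
    by apply: nbhs_upper_set => // x _ [].
  apply: sub_finite_set => F [AF CF]; split => // FC; apply: CF => x Cx Fx.
  exact: FC Fx Cx.
move=> F W /nbhs_hyperspaceP[C [tC _ CW]].
apply: sub_finite_set (fin _ tC) => G [AG WG]; split => // CG; apply: WG.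
by apply: CW => x Gx Cx; exact: CG Cx Gx.
Qed.

End Hyperspace.

Lemma closed_subset_inj (X : topologicalType) :
  injective (@closed_subset_set X).
Proof.
move=> [F cF] [G cG] /= FG; case: _ / FG in cG *.
by congr ClosedSubset; exact: Prop_irrelevance.
Qed.

Definition complement {X : topologicalType} (F : closed_subset X) : set X := ~` F.

Lemma complement_inj (X : topologicalType) : injective (@complement X).
Proof. by move=> F G /setC_inj /closed_subset_inj. Qed.

Lemma complement_image (X : topologicalType) (U : set (set X)) :
  (forall V, U V -> open V) ->
  complement @` (complement @^-1` U) = U.
Proof.
move=> oU; apply/seteqP; split=> [_ [F UF <-]//|V UV].
by exists (ClosedSubset (open_closedC (oU V UV))); rewrite /complement /= setCK.
Qed.

(** * Covers as families of complements of closed sets *)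

Section Covers.
Variables (t : upper_topology) (X : topologicalType).
Implicit Types (E : closed_subset X) (A : set (closed_subset X)) (C V : set X).
Implicit Types (U : set (set X)).

Let tests := @upper_tests t X.

Lemma open_cover_tests U : (forall V, U V -> open V) -> ~ U setT ->
  (forall x, exists2 V, U V & V x) -> open_cover U.
Proof.
move=> oU UT cU; split => //; apply/seteqP; split=> // x _.
by have [V] := cU x; exists V.
Qed.

Lemma omega_coversP U : omega_covers tests U <->
  [/\ forall V, U V -> open V, ~ U setT &
    forall C, tests C -> exists2 V, U V & C `<=` V].
Proof.
split=> [[[oU _ UT] tU]//|[oU UT tU]]; split=> //.
apply: open_cover_tests => // x.
by have [V UV xV] := tU _ (@upper_tests1 t X x); exists V => //; exact: xV.
Qed.

Lemma gamma_coversP U : gamma_covers tests U <->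
  [/\ forall V, U V -> open V, ~ U setT, infinite_set U &
    forall C, tests C -> finite_set [set V | U V /\ ~ C `<=` V]].
Proof.
split=> [[[oU _ UT] Uinf fin]//|[oU UT Uinf fin]]; split=> //.
apply: open_cover_tests => // x; have := fin _ (@upper_tests1 t X x).
move=> /(infinite_setD Uinf) /infinite_setN0[V [UV nV]]; exists V => //.
by apply: contrapT => Vx; apply: nV; split => // /(_ x erefl).
Qed.

Lemma complement_eqT A : (complement @` A) setT = A (empty_closed X).
Proof.
apply/propext; split=> [[F AF FT]|A0]; last first.
  by exists (empty_closed X) => //; exact: setC0.
suff <- : F = empty_closed X by [].
by apply: complement_inj; rewrite FT /complement setC0.
Qed.

Lemma complement_open A V : (complement @` A) V -> open V.
Proof. by move=> [F _ <-]; exact/closed_openC/closed_subsetP. Qed.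

Lemma D_Omega_complement A :
  D_Omega t A <-> omega_covers tests (complement @` A).
Proof.
rewrite D_OmegaE Omega_atP omega_coversP complement_eqT.
split=> [[A0 tA]|[_ A0 tA]]; split=> //; first exact: complement_open.
  move=> C tC; have [|F AF CF] := tA C tC; first by move=> x _ [].
  by exists (complement F) => //; exists F.
by move=> C tC _; have [_ [F AF <-] CF] := tA C tC; exists F.
Qed.

Lemma D_Gamma_complement A :
  D_Gamma t A <-> gamma_covers tests (complement @` A).
Proof.
have finE B : finite_set (complement @` B) = finite_set B.
  apply/propext; split; last exact: finite_image.
  move=> finB; have : finite_set (complement @^-1` (complement @` B)).
    by apply: finite_preimage finB => F G _ _ /complement_inj.
  by apply: sub_finite_set => F BF; exists F.
have imE C : [set V | (complement @` A) V /\ ~ C `<=` V] =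
    complement @` [set F | A F /\ ~ C `<=` ~` F].
  apply/seteqP; split=> [_ [[F AF <-] CF]|_ [F [AF CF] <-]]; first by exists F.
  by split => //; exists F.
rewrite D_GammaP gamma_coversP complement_eqT finE.
split=> [[Ainf A0 fin]|[_ A0 Ainf fin]]; split=> //.
- exact: complement_open.
- by move=> C tC; rewrite imE finE; exact: fin.
- by move=> C tC; rewrite -finE -imE; exact: fin.
Qed.

(** The range is infinite because no value recurs infinitely often: a point outside [v k] lies in
    [v n] for all large [n], so [v n] differs from [v k]. *)
Lemma gamma_covers_range (v : nat -> set X) :
  (forall n, open (v n)) -> (forall n, v n <> setT) ->
  (forall C, tests C -> \forall n \near \oo, C `<=` v n) ->
  gamma_covers tests (range v).
Proof.
move=> ov vT cv; apply/gamma_coversP; split.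
- by move=> _ [n _ <-].
- by move=> [n _] /vT.
- apply: infinite_range_near => k.
  have /setTPn[x vkx] : v k != setT by exact/eqP.
  apply: filterS (cv _ (@upper_tests1 t X x)) => n /(_ x erefl) vnx vnk.
  by apply: vkx; rewrite -vnk.
- move=> C tC; apply: (@finite_range_near _ v [set V | ~ C `<=` V]).
  by apply: filterS (cv C tC) => n Cv.
Qed.

Lemma gamma_covers_sequence U : gamma_covers tests U ->
  exists v : nat -> set X, (forall n, U (v n)) /\
    forall C, tests C -> \forall n \near \oo, C `<=` v n.
Proof.
move=> [_ /infinite_set_sequence[v [Uv vP]] fin]; exists v; split => // C tC.
by apply: filterS (vP _ (fin C tC)) => n CV; apply: contrapT => nCv; exact: CV.
Qed.

(** A member of [D_Gamma] may be uncountable, so only a sequence drawn from it can belong to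
    [Gamma_at]. This is enough, as a selection from a subfamily is a selection from the family. *)
Lemma D_Gamma_Gamma_at A : D_Gamma t A ->
  exists2 A', A' `<=` A & Gamma_at t (empty_closed X) A'.
Proof.
move=> /D_GammaP[/infinite_set_sequence[u [Au uP]] A0 fin].
exists (range u); first by move=> _ [n _ <-].
split; first by move=> [n _ un0]; apply: A0; rewrite -un0.
exists u => //; apply/hyperspace_cvgP => C tC _.
by apply: filterS (uP _ (fin C tC)) => n CV; apply: contrapT => nCv; exact: CV.
Qed.

(** Repetitions cannot make the family finite: the complements of its terms are proper open sets
    that eventually contain each test set, so [gamma_covers_range] applies. *)
Lemma Gamma_at_D_Gamma A : Gamma_at t (empty_closed X) A -> D_Gamma t A.
Proof.
move=> [A0 [u Au /hyperspace_cvgP uP]]; apply/D_Gamma_complement.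
have cvu C : tests C -> \forall n \near \oo, C `<=` complement (u n).
  by move=> tC; apply: uP => // x _ [].
rewrite Au image_comp; apply: (gamma_covers_range (complement \o u)) => //.
- by move=> n; exact/closed_openC/closed_subsetP.
- move=> n unT; apply: A0; rewrite -complement_eqT; exists (u n) => //.
  by rewrite Au; exists n.
Qed.

End Covers.

(** * A common form of the two selection principles *)

Definition picks {T : Type} (s : selection_kind) (b a : set T) : Prop :=
  match s with
  | SelOne => exists2 x, a x & b = [set x]
  | SelFin => finite_set b /\ b `<=` a
  end.

Section Selection.
Variables (S T : Type) (s : selection_kind).

Lemma picks_sub {a b : set T} : picks s b a -> b `<=` a.
Proof. by case: s => [[x ax ->] _ ->|[]]. Qed.

Lemma picks_finite {a b : set T} : picks s b a -> finite_set b.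
Proof. by case: s => [[x _ ->]|[]//]; exact: finite_set1. Qed.

Lemma picks_subset (a a' b : set T) : a `<=` a' -> picks s b a -> picks s b a'.
Proof.
move=> aa'; case: s => [[x ax ->]|[fb ba]]; first by exists x => //; exact: aa'.
by split => //; exact: subset_trans aa'.
Qed.

Lemma picks1 (a : set T) x : a x -> picks s [set x] a.
Proof.
by move=> ax; case: s; [exists x | split; [exact: finite_set1 | move=> _ ->]].
Qed.

Lemma picks_image (f : S -> T) (a b : set S) :
  picks s b a -> picks s (f @` b) (f @` a).
Proof.
case: s => [[x ax ->]|[fb ba]]; first by rewrite image_set1; exists (f x).
by split; [exact: finite_image | exact: image_subset].
Qed.

Lemma picks_lift {f : S -> T} {a : set S} {b : set T} :
  picks s b (f @` a) -> exists2 c, picks s c a & f @` c = b.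
Proof.
case: s => [[_ [x ax <-] ->]|[fb ba]].
  by exists [set x]; [exists x | rewrite image_set1].
(* One preimage is chosen for each element of [b]; outside [b] the value is the default [set0]. *)
have /choice[c cP] (y : T) : exists c : set S,
    b y -> [/\ finite_set c, c `<=` a & f @` c = [set y]].
  have [/ba[x ax <-]|nby] := pselect (b y); last by exists set0.
  exists [set x] => _; split; last by rewrite image_set1.
    exact: finite_set1.
  by move=> _ ->.
exists (\bigcup_(y in b) c y).
  split; first by apply: bigcup_finite => // y /cP[].
  by move=> x [y /cP[_ ca _] /ca].
rewrite image_bigcup; apply/seteqP; split=> [z [y by_]|y by_].
  by have [_ _ ->] := cP _ by_; move=> ->.
by exists y => //; have [_ _ ->] := cP _ by_.
Qed.

(** Reading a choice of points as a choice of singletons lets one argument serve both principles. *)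
Lemma selectsP (A B : set (set T)) : selects s A B <->
  forall a : nat -> set T, (forall n, A (a n)) ->
    exists b : nat -> set T, (forall n, picks s (b n) (a n)) /\ B (\bigcup_n b n).
Proof.
case: s; split=> // sel a /sel[b [ab Bb]].
  exists (fun n => [set b n]); split=> [n|]; first by exists (b n).
  by rewrite bigcup_imset1.
have /choice[v vP] n : exists x, a n x /\ b n = [set x].
  by have [x ax bx] := ab n; exists x.
exists v; split=> [n|]; first by have [] := vP n.
suff -> : range v = \bigcup_n b n by [].
by rewrite -bigcup_imset1; apply: eq_bigcupr => n _; have [] := vP n.
Qed.

End Selection.

Arguments picks_sub {T s a b}.
Arguments picks_finite {T s a b}.
Arguments picks_lift {S T s f a b}.

Lemma selects_fin (T : Type) (s : selection_kind) (A B : set (set T)) :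
  selects s A B -> Sfin A B.
Proof.
move=> /selectsP sel a /sel[b [ab Bb]]; exists b; split => // n.
by split; [exact: picks_finite (ab n) | exact: picks_sub (ab n)].
Qed.

(** * Passing between covers, dense or convergent families, and the point [empty_closed X] *)

Section Transfer.
Variables (X : topologicalType) (star : selection_kind).
Variables (Phi : phi_class) (Psi : psi_class).

Lemma D_phi_complement (A : set (closed_subset X)) :
  D_phi Phi A <-> covers_phi Phi (complement @` A).
Proof.
by case: Phi; [exact: D_Gamma_complement | exact: D_Omega_complement].
Qed.

Lemma D_psi_complement (A : set (closed_subset X)) :
  D_psi Psi A <-> covers_psi Psi (complement @` A).
Proof.
by case: Psi; [exact: (@D_Gamma_complement UpperZ)
  | exact: (@D_Omega_complement UpperZ)].
Qed.

Lemma covers_phi_open (U : set (set X)) V : covers_phi Phi U -> U V -> open V.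
Proof. by case: Phi => [[[oU _ _] _ _]|[[oU _ _] _]]; exact: oU. Qed.

Lemma selects_covers_D : selects star (@covers_phi X Phi) (@covers_psi X Psi) <->
  selects star (@D_phi X Phi) (@D_psi X Psi).
Proof.
rewrite !selectsP; split=> sel a aP.
  have [|b [ab Bb]] := sel (fun n => complement @` a n).
    by move=> n; exact/D_phi_complement.
  have /choice[c cP] n : exists c, picks star c (a n) /\ complement @` c = b n.
    by have [c] := picks_lift (ab n); exists c.
  exists c; split=> [n|]; first by have [] := cP n.
  apply/D_psi_complement; rewrite image_bigcup.
  suff -> : \bigcup_n complement @` c n = \bigcup_n b n by [].
  by apply: eq_bigcupr => n _; have [] := cP n.
(* Members of the covers are open, hence are complements of closed sets, and nothing is lost by
   pulling back. *)
have aE n : complement @` (complement @^-1` a n) = a n.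
  by apply: complement_image => V; exact: covers_phi_open (aP n).
have [|b [ab Bb]] := sel (fun n => complement @^-1` a n).
  by move=> n; apply/D_phi_complement; rewrite aE.
exists (fun n => complement @` b n); split=> [n|].
  by rewrite -aE; exact: picks_image.
by rewrite -image_bigcup; exact/D_psi_complement.
Qed.

Lemma selects_at_empty_D :
  selects star (phi_at Phi (empty_closed X)) (psi_at Psi (empty_closed X)) ->
  selects star (@D_phi X Phi) (@D_psi X Psi).
Proof.
move=> /selectsP sel; apply/selectsP => a aP.
have /choice[a' a'P] n : exists a', a' `<=` a n /\ phi_at Phi (empty_closed X) a'.
  move: (aP n); case: Phi => [/D_Gamma_Gamma_at[a' aa' a'P]|].
    by exists a'.
  by rewrite /D_phi D_OmegaE => aO; exists (a n); split.
have [n|b [ab Bb]] := sel a'; first by have [] := a'P n.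
exists b; split=> [n|]; first by have [aa' _] := a'P n; exact: picks_subset (ab n).
by case: Psi Bb => [/Gamma_at_D_Gamma//|]; rewrite /D_psi D_OmegaE.
Qed.

End Transfer.

(** * From covers to selection at an arbitrary closed set *)

Section CoversToHyperspace.
Variables (X : topologicalType).

(** For [Phi_K] all pairwise intersections are taken. For [Phi_Gamma_k] this could fail, since one
    [u] not containing [C] may meet the sets [v] in infinitely many ways; the intersections are
    therefore taken termwise along two sequences. *)
Lemma covers_phi_refine {Phi} {U V : set (set X)} :
  covers_phi Phi U -> covers_phi Phi V -> exists2 W, covers_phi Phi W &
    forall w, W w -> (exists2 u, U u & w `<=` u) /\ (exists2 v, V v & w `<=` v).
Proof.
case: Phi => [UP VP|].
  have [u [Uu uP]] := gamma_covers_sequence UpperFell _ _ UP.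
  have [v [Vv vP]] := gamma_covers_sequence UpperFell _ _ VP.
  have [oU UT _ _] := (gamma_coversP UpperFell _ _).1 UP.
  have [oV _ _ _] := (gamma_coversP UpperFell _ _).1 VP.
  exists (range (fun n => u n `&` v n)); last first.
    by move=> _ [n _ <-]; split; [exists (u n) | exists (v n)].
  apply: (gamma_covers_range UpperFell) => [n|n uvT|C cC].
  - by apply: openI; [exact: oU | exact: oV].
  - apply: UT; suff <- : u n = setT by exact: Uu.
    by rewrite -subTset -uvT; exact: subIsetl.
  - apply: filterS2 (uP _ cC) (vP _ cC) => n Cu Cv x Cx.
    by split; [exact: Cu | exact: Cv].
move=> /(omega_coversP UpperFell)[oU UT tU] /(omega_coversP UpperFell)[oV _ tV].
exists [set w | exists u v, [/\ U u, V v & w = u `&` v]]; last first.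
  by move=> _ [u [v [Uu Vv ->]]]; split; [exists u | exists v].
apply/(omega_coversP UpperFell); split.
- by move=> _ [u [v [Uu Vv ->]]]; apply: openI; [exact: oU | exact: oV].
- move=> [u [v [Uu _ uvT]]]; apply: UT; suff <- : u = setT by [].
  by rewrite -subTset uvT; exact: subIsetl.
- move=> C cC; have [u Uu Cu] := tU C cC; have [v Vv Cv] := tV C cC.
  by exists (u `&` v); [exists u, v | move=> x Cx; split; [exact: Cu|exact: Cv]].
Qed.

Lemma covers_phi_refine_sequence Phi (U : nat -> set (set X)) :
  (forall n, covers_phi Phi (U n)) -> exists W : nat -> set (set X),
    (forall n, covers_phi Phi (W n)) /\
    forall m n, m <= n -> forall w, W n w -> exists2 u, U m u & w `<=` u.
Proof.
move=> UP.
(* The refinement is made a total function on pairs, with the default [set0] when some component is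
   not a cover, so that it can be iterated. *)
have /choice[r rP] (p : set (set X) * set (set X)) :
    exists W, covers_phi Phi p.1 -> covers_phi Phi p.2 -> covers_phi Phi W /\
      forall w, W w ->
        (exists2 u, p.1 u & w `<=` u) /\ (exists2 v, p.2 v & w `<=` v).
  have [p1|] := pselect (covers_phi Phi p.1); last by exists set0.
  have [p2|] := pselect (covers_phi Phi p.2); last by exists set0.
  by have [W WP Wr] := covers_phi_refine p1 p2; exists W.
pose W := fix W n := if n is n'.+1 then r (W n', U n) else U 0.
have WP n : covers_phi Phi (W n).
  by elim: n => [|n IH]; [exact: UP | have [] := rP (W n, U n.+1) IH (UP _)].
exists W; split => // m; elim=> [|n IH].
  by rewrite leqn0 => /eqP -> w ?; exists w.
have [_ Wr] := rP (W n, U n.+1) (WP n) (UP _).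
rewrite leq_eqVlt => /orP[/eqP -> w /Wr[]//|]; rewrite ltnS => /IH {}IH w.
move=> /Wr[[w' Ww' ww'] _]; have [u Uu w'u] := IH _ Ww'.
by exists u => //; exact: subset_trans w'u.
Qed.

(* The cover produced by the principle may repeat an element infinitely often,
   so it need not converge as a sequence: hence the decreasing refinements and
   the choice of [v m] outside the first [m] finite sets. *)
Lemma Sfin_gamma_sequence Phi :
  Sfin (@covers_phi X Phi) (gamma_covers (@finite_set X)) ->
  forall U : nat -> set (set X), (forall n, covers_phi Phi (U n)) ->
  exists u : nat -> set X, (forall n, U n (u n)) /\
    forall C, finite_set C -> \forall n \near \oo, C `<=` u n.
Proof.
move=> sel U /covers_phi_refine_sequence[W [WP Wr]].
have [b [bW [_ binf fin]]] := sel W WP.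
have /choice[v vP] m :
    exists v, (exists2 k, m <= k & b k v) /\ forall k, k < m -> ~ b k v.
  have finm : finite_set (\bigcup_(k in `I_m) b k).
    by apply: bigcup_finite => // k _; have [] := bW k.
  have [v [[k _ bkv] nv]] := infinite_setN0 (infinite_setD binf finm).
  have vm j : j < m -> ~ b j v by move=> jm bjv; apply: nv; exists j.
  exists v; split => //; exists k => //; rewrite leqNgt; apply/negP => km.
  exact: vm bkv.
have /choice[u uP] m : exists u, U m u /\ v m `<=` u.
  have [[k mk bkv] _] := vP m; have [u Uu vu] := Wr _ _ mk _ ((bW k).2 _ bkv).
  by exists u.
exists u; split=> [n|C finC]; first by have [] := uP n.
suff : \forall n \near \oo, C `<=` v n.
  by apply: filterS => n Cv; apply: subset_trans Cv _; have [] := uP n.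
(* Only finitely many selected [w] fail to contain [C]. If [w] lies in [b k], then [v n = w] forces
   [n <= k], so the set of bad indices is a finite union of finite sets. *)
have : finite_set (\bigcup_(w in [set w | (\bigcup_n b n) w /\ ~ C `<=` w])
    [set n | v n = w]).
  apply: bigcup_finite => [|w [[k _ bkw] _]]; first exact: fin.
  apply/near_finite_set; exists k.+1 => // n /= kn vnw.
  by have [_ /(_ k kn)] := vP n; rewrite vnw.
move=> /near_finite_set; apply: filterS => n nP; apply: contrapT => nCv.
apply: nP; exists (v n) => //; split => //.
by have [[k _ bkv] _] := vP n; exists k.
Qed.

(** Add to [C] one missing point for each of the finitely many sets in the first [N] selections. A
    selected set containing this larger finite set must come from a later index. *)
Lemma omega_covers_tail (b : nat -> set (set X)) :
  (forall n, finite_set (b n)) ->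
  omega_covers (@finite_set X) (\bigcup_n b n) ->
  forall C N, finite_set C -> exists n, N <= n /\ exists2 V, b n V & C `<=` V.
Proof.
move=> finb /(omega_coversP UpperZ)[_ bT tb] C N finC.
have /choice[p pP] (V : set X) :
    exists p, finite_set p /\ (V <> setT -> ~ p `<=` V).
  have [VT|/eqP/setTPn[x Vx]] := pselect (V = setT); first by exists set0.
  by exists [set x]; split; [exact: finite_set1 | move=> _ /(_ x erefl)].
pose D := C `|` \bigcup_(V in \bigcup_(n in `I_N) b n) p V.
have finD : finite_set D.
  rewrite finite_setU; split => //; apply: bigcup_finite => [|V _].
    by apply: bigcup_finite.
  by have [] := pP V.
have [V [n _ bnV] DV] := tb D finD; exists n; split; last first.
  by exists V => // x Cx; apply: DV; left.
rewrite leqNgt; apply/negP => nN; have [_] := pP V; apply.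
  by move=> VT; apply: bT; exists n => //; rewrite -VT.
by move=> x px; apply: DV; right; exists V => //; exists n.
Qed.

(** Finite unions of the given closed sets make the sequence increasing, so a compact set inside one
    term stays inside all later ones. *)
Lemma kFsigma_exhaustion (A : set X) : kFsigma A ->
  exists G : nat -> set X, [/\ forall n, closed (G n), forall n, G n `<=` A &
    forall C, compact C -> C `<=` A -> \forall n \near \oo, C `<=` G n].
Proof.
move=> [F [-> cF FP]]; exists (fun n => \bigcup_(i in `I_n) F i); split.
- by move=> n; apply: closed_bigcup.
- by move=> n x [i _ Fix]; exists i.
- move=> C cC CA; have [i CF] := FP C cC CA; exists i.+1 => // n /= ni x Cx.
  by exists i => //; exact: CF.
Qed.

Lemma phi_at_nonempty {Phi E} {A : set (closed_subset X)} :
  phi_at Phi E A -> ~ A E /\ A !=set0.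
Proof.
case: Phi => [[AE [a Aa _]]|/(Omega_atP UpperFell)[AE AC]]; split => //.
  by rewrite Aa; exists (a 0); exists 0.
by have [|F AF _] := AC set0 compact0; [exact: sub0set | exists F].
Qed.

Lemma phi_at_covers Phi (E : closed_subset X)
    (A : set (closed_subset X)) (G : set X) :
  closed G -> G `<=` ~` E -> phi_at Phi E A ->
  (forall F, A F -> ~ G `<=` complement F) ->
  covers_phi Phi ((fun F => complement F `|` ~` G) @` A).
Proof.
move=> cG GE AP AG.
have oFG F : open (complement F `|` ~` G).
  by apply: openU; apply: closed_openC => //; exact: closed_subsetP.
have FGT F : A F -> complement F `|` ~` G <> setT.
  move=> AF FGT; apply: (AG F AF) => x Gx.
  by have : setT x by []; rewrite -FGT => -[].
have meetG C (F : closed_subset X) :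
    C `&` G `<=` complement F -> C `<=` complement F `|` ~` G.
  by move=> CGF x Cx; have [Gx|Gx] := pselect (G x); [left; apply: CGF | right].
have CGE C : C `&` G `<=` ~` E by move=> x [_ /GE].
case: Phi AP => [[_ [a Aa /(hyperspace_cvgP UpperFell) aE]]|].
  rewrite Aa image_comp.
  apply: (gamma_covers_range UpperFell _ (fun n => complement (a n) `|` ~` G)) => //.
    by move=> n; apply: FGT; rewrite Aa; exists n.
  move=> C cC; have := aE _ (compact_closedI cC cG) (CGE C).
  by apply: filterS => n; exact: meetG.
move=> /(Omega_atP UpperFell)[_ AC]; apply/(omega_coversP UpperFell); split.
- by move=> _ [F _ <-].
- by move=> [F AF /(FGT F AF)].
- move=> C cC; have [F AF CF] := AC _ (compact_closedI cC cG) (CGE C).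
  by exists (complement F `|` ~` G); [exists F | exact: meetG].
Qed.


(* For [Psi_Gamma] both selection principles yield single elements. *)
Definition limit_kind (star : selection_kind) (Psi : psi_class) :=
  if Psi is Psi_Gamma then SelOne else star.

(** The indices are kept, rather than only the union of the [b n], because [C] lies in the
    exhausting set [G n] only for large [n]: the [Psi_Omega] case needs arbitrarily late
    witnesses. *)
Definition cover_limit (Psi : psi_class) (A : set X) (b : nat -> set (set X)) :=
  forall C, finite_set C -> C `<=` A ->
  match Psi with
  | Psi_Gamma => \forall n \near \oo, forall V, b n V -> C `<=` V
  | Psi_Omega => forall N, exists n, N <= n /\ exists2 V, b n V & C `<=` V
  end.

Lemma cover_limitT Psi A : cover_limit Psi A (fun=> [set setT]).
Proof.
move=> C _ _; case: Psi => [|N]; first by apply: nearW => n V ->.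
by exists N; split => //; exists setT.
Qed.

(** For [Psi_Gamma] the principle is first weakened to [Sfin], from which a convergent sequence of
    single elements is recovered. For [Psi_Omega] late witnesses come from [omega_covers_tail]. *)
Lemma selects_cover_limit {star Phi Psi} A :
  selects star (@covers_phi X Phi) (@covers_psi X Psi) ->
  forall U : nat -> set (set X), (forall n, covers_phi Phi (U n)) ->
  exists b, (forall n, picks (limit_kind star Psi) (b n) (U n)) /\
    cover_limit Psi A b.
Proof.
case: Psi => [/selects_fin sel U UP|/selectsP sel U /sel[b [bU bP]]].
  have [u [Uu uP]] := Sfin_gamma_sequence _ sel U UP.
  exists (fun n => [set u n]); split=> [n|C finC _]; first exact: picks1.
  by apply: filterS (uP C finC) => n Cu _ ->.
exists b; split => // C finC _ N; apply: omega_covers_tail => // n.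
exact: picks_finite (bU n).
Qed.

(** Some [U n] need not be covers, namely where a family has a member missing [G n]. They are
    replaced by a fixed cover [U n0]; if there is no cover at all, the constant [[set setT]]
    satisfies the limit condition. *)
Lemma selects_cover_partial {star Phi Psi} A :
  selects star (@covers_phi X Phi) (@covers_psi X Psi) ->
  forall U : nat -> set (set X), exists b,
    (forall n, covers_phi Phi (U n) -> picks (limit_kind star Psi) (b n) (U n)) /\
    cover_limit Psi A b.
Proof.
move=> sel U; have [[n0 Un0]|noU] := pselect (exists n, covers_phi Phi (U n)).
  pose U' n := if pselect (covers_phi Phi (U n)) then U n else U n0.
  have [|b [bU' bP]] := selects_cover_limit A sel U'.
    by move=> n; rewrite /U'; case: pselect.
  by exists b; split => // n Un; have := bU' n; rewrite /U'; case: pselect.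
exists (fun=> [set setT]); split; last exact: cover_limitT.
by move=> n Un; case: noU; exists n.
Qed.

Lemma psi_at_limit star Psi (E : closed_subset X) (G : nat -> set X)
    (a c : nat -> set (closed_subset X)) (b : nat -> set (set X)) :
  (forall C, compact C -> C `<=` ~` E -> \forall n \near \oo, C `<=` G n) ->
  (forall n, ~ a n E) ->
  (forall n, picks (limit_kind star Psi) (c n) (a n)) ->
  (forall n, (exists2 F, c n = [set F] & G n `<=` complement F) \/
             (fun F => complement F `|` ~` G n) @` c n = b n) ->
  cover_limit Psi (~` E) b ->
  psi_at Psi E (\bigcup_n c n).
Proof.
move=> GP aE ca cP bP.
have cE : ~ (\bigcup_n c n) E by move=> [n _ /(picks_sub (ca n))]; exact: aE.
have GC C : finite_set C -> C `<=` ~` E -> \forall n \near \oo, C `<=` G n.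
  by move=> finC CE; apply: GP => //; exact: finite_compact.
have CF C n F : C `<=` G n -> C `<=` complement F `|` ~` G n ->
    C `<=` complement F.
  by move=> CG CFG x Cx; have [//|] := CFG x Cx; case; exact: CG.
case: Psi ca bP => ca bP; last first.
  apply/(Omega_atP UpperZ); split => // C finC CE.
  have [N _ NG] := GC C finC CE.
  (* The index is taken beyond [N], where [C]<=[G n]; thus either kind of choice at [n] gives an [F]
     that misses [C]. *)
  have [n [Nn [V bV CV]]] := bP C finC CE N.
  have [[F cF GF]|cb] := cP n.
    exists F; first by exists n => //; rewrite cF.
    by apply: subset_trans GF; exact: NG.
  move: bV; rewrite -cb => -[F cF FV]; exists F; first by exists n.
  by apply: (CF C n); [exact: NG | rewrite FV].
have /choice[u uP] n : exists F, c n = [set F] by have [F _] := ca n; exists F.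
split => //; exists u; first by rewrite -bigcup_imset1; apply: eq_bigcupr.
apply/(hyperspace_cvgP UpperZ) => C finC CE.
apply: filterS2 (GC C finC CE) (bP C finC CE) => n CG bn.
have [[F cF GF]|cb] := cP n.
  have -> : u n = F by have : [set F] (u n) by rewrite -cF uP.
  exact: subset_trans GF.
apply: (CF C n) => //; apply: bn; rewrite -cb; exists (u n) => //.
by rewrite uP.
Qed.

Lemma selects_covers_at star Phi Psi (E : closed_subset X) : kperfect X ->
  selects star (@covers_phi X Phi) (@covers_psi X Psi) ->
  selects star (phi_at Phi E) (psi_at Psi E).
Proof.
move=> kX sel; apply/selectsP => a aP.
have [|G [cG GE GP]] := kFsigma_exhaustion (~` E).
  exact/kX/closed_openC/closed_subsetP.
pose f n (F : closed_subset X) := complement F `|` ~` G n.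
have [b [bf bP]] := selects_cover_partial (~` E) sel (fun n => f n @` a n).
have /choice[c cP] n : exists c, picks (limit_kind star Psi) c (a n) /\
    ((exists2 F, c = [set F] & G n `<=` complement F) \/ f n @` c = b n).
  (* A member missing [G n] is selected outright; otherwise the sets [f n F] form a cover, and the
     choice made from it is lifted back to [a n]. *)
  have [[F [aF GF]]|noF] := pselect (exists F, a n F /\ G n `<=` complement F).
    by exists [set F]; split; [exact: picks1 | left; exists F].
  have [|c ca cb] := picks_lift (bf n _); last by exists c; split => //; right.
  apply: phi_at_covers (aP n) _ => // F aF GF.
  by apply: noF; exists F.
exists c; split=> [n|].
  (* For [Psi_Gamma] the choice is a singleton, which is admissible for either value of [star]. *)
  have [+ _] := cP n; rewrite /limit_kind.
  case: (Psi) => // -[F aF ->].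
  exact: picks1.
apply: (psi_at_limit star _ _ G a c b) => // n.
- by have [] := phi_at_nonempty (aP n).
- by have [] := cP n.
- by have [] := cP n.
Qed.

End CoversToHyperspace.

Theorem theorem5p9 (X : topologicalType) (star : selection_kind)
    (Phi : phi_class) (Psi : psi_class) :
  hausdorff_space X -> ~ compact [set: X] -> kperfect X ->
  [<-> selects star (@covers_phi X Phi) (@covers_psi X Psi);
       selects star (@D_phi X Phi) (@D_psi X Psi);
       forall E : closed_subset X, selects star (phi_at Phi E) (psi_at Psi E)].
Proof.
move=> _ _ kX; tfae.
- by move=> /selects_covers_D.
- by move=> /selects_covers_D sel E; exact: selects_covers_at.
- by move=> sel; apply/selects_covers_D/selects_at_empty_D.
Qed.
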